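(* For every positive integer $n$, every $n \times n$ permutation grid admits a complete non-attacking rook placement.
   Context: An $n \times n$ crossword grid is an $n\times n$ array of squares, each white or black. A permutation grid is an $n \times n$ crossword grid with exactly one black square in each row and exactly one black square in each column. An across word is a maximal (non-empty) contiguous sequence of white squares within a single row; a down word is a maximal (non-empty) contiguous sequence of white squares within a single column. A complete non-attacking rook placement on a grid is a subset of its white squares containing exactly one square of every across word and exactly one square of every down word (for $n=1$ the only permutation grid has no words and the empty set is a complete placement). *)

(* Defs.v *)
From mathcomp Require Import all_boot.

Set Implicit Arguments.
Unset Strict Implicit.
Unset Printing Implicit Defensive.

(* Squares are pairs (row, column); a grid is given by its set of black
   squares, the other squares being white. *)
Definition square (n : nat) : finType := ('I_n * 'I_n)%type.
Definition crossword_grid (n : nat) := {set square n}.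

Definition white (n : nat) (B : crossword_grid n) : {set square n} := ~: B.

Definition permutation_grid (n : nat) (B : crossword_grid n) : Prop :=
  (forall i : 'I_n, #|[set j : 'I_n | (i, j) \in B]| = 1) /\
  (forall j : 'I_n, #|[set i : 'I_n | (i, j) \in B]| = 1).

Definition row_interval (n : nat) (i a b : 'I_n) : {set square n} :=
  [set s : square n | (s.1 == i) && (a <= s.2 <= b)].

Definition col_interval (n : nat) (j a b : 'I_n) : {set square n} :=
  [set s : square n | (s.2 == j) && (a <= s.1 <= b)].

(* The condition a <= b makes the runs non-empty. *)
Definition across_run (n : nat) (B : crossword_grid n) :
    pred {set square n} := fun W =>
  [exists i : 'I_n, exists a : 'I_n, exists b : 'I_n,
    [&& a <= b, W == row_interval i a b & W \subset white B]].

Definition down_run (n : nat) (B : crossword_grid n) :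
    pred {set square n} := fun W =>
  [exists j : 'I_n, exists a : 'I_n, exists b : 'I_n,
    [&& a <= b, W == col_interval j a b & W \subset white B]].

Definition across_word (n : nat) (B : crossword_grid n) (W : {set square n}) :
  bool := maxset (across_run B) W.

Definition down_word (n : nat) (B : crossword_grid n) (W : {set square n}) :
  bool := maxset (down_run B) W.

Definition complete_rook_placement (n : nat) (B : crossword_grid n)
    (R : {set square n}) : Prop :=
  [/\ R \subset white B,
      forall W : {set square n}, across_word B W -> #|R :&: W| = 1
    & forall W : {set square n}, down_word B W -> #|R :&: W| = 1].

(* Main.v *)
Require Import Defs.
From mathcomp Require Import all_boot zify.

(* Let [s] be the permutation sending a row to the column of its black square
   and [t] its inverse.  We induct on [k] over the subgrid formed by the rows
   [x < k] and the columns whose black square lies in one of these rows.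
   Passing from [k + 1] to [k + 2] rows inserts column [c = s (k + 1)] and
   row [k + 1]; the column [j0 = s k] gets a new down word, consisting of the
   square [(k + 1, j0)] only, which must carry a rook.
   If all the other old columns lie on the same side of [c] as [j0], the one
   nearest to [c] has its black square in a row [i0] that gets the new across
   word [{(i0, c)}], and adding rooks at [(k + 1, j0)] and [(i0, c)] suffices.
   Otherwise let [j] be the old column nearest to [c] on the side opposite to
   [j0], and let [(x, j)] be the rook below the black square of column [j].
   Since [j] is nearest, the black square of row [x] is not between [j] and
   [c], so the rook [(x, j)] can be replaced by the two rooks [(k + 1, j)]
   and [(x, c)], to which one adds [(k + 1, j0)]. *)

Set Implicit Arguments.
Unset Strict Implicit.
Unset Printing Implicit Defensive.

(** * Partial placements on subgrids, whose columns keep their indices from the full grid *)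

Definition active (s t : nat -> nat) (k x y : nat) : Prop :=
  [/\ x < k, t y < k & y <> s x].

(* Two squares of row [x] are in the same across word iff they are on the same
   side of [s x]; likewise for columns. *)
Record placement (s t : nat -> nat) (k : nat) (R : rel nat) : Prop :=
  Placement {
  placement_active : forall x y, R x y -> active s t k x y;
  across_ex : forall x y, active s t k x y ->
    exists2 y', R x y' & (y' < s x) = (y < s x);
  down_ex : forall x y, active s t k x y ->
    exists2 x', R x' y & (x' < t y) = (x < t y);
  across_inj : forall x y y', R x y -> R x y' ->
    (y < s x) = (y' < s x) -> y = y';
  down_inj : forall x x' y, R x y -> R x' y ->
    (x < t y) = (x' < t y) -> x = x' }.

(** The absolute difference, through truncated subtraction. *)
Definition dist (c y : nat) : nat := (y - c) + (c - y).

Lemma bounded_argmin (k : nat) (P : pred nat) (f : nat -> nat) (x0 : nat) :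
  x0 < k -> P x0 ->
  exists x, [/\ x < k, P x & forall z, z < k -> P z -> f x <= f z].
Proof.
move=> x0k Px0.
case: (@arg_minnP _ (Ordinal x0k) (fun i : 'I_k => P i) (fun i => f i)) => //.
move=> i Pi min_i; exists i; split=> // z zk Pz.
exact: (min_i (Ordinal zk)).
Qed.

(** * Inserting row [k.+1] and column [c] *)

Section Step.
Variables (s t : nat -> nat) (sK : cancel s t) (tK : cancel t s).

Lemma placement1 : placement s t 1 (fun _ _ => false).
(* The only square of the one by one subgrid is black, so there is no word to cover. *)
Proof.
have noact x y : ~ active s t 1 x y.
  case=> x1 y1 yx; have e : x = t y by lia.
  by apply: yx; rewrite e tK.
by split=> // x y /noact.
Qed.

Variables (k : nat) (R : rel nat).
Hypothesis pR : placement s t k.+1 R.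
Let c := s k.+1.
Let j0 := s k.

Let tc : t c = k.+1. Proof. exact: sK. Qed.
Let tj0 : t j0 = k. Proof. exact: sK. Qed.
Let j0c : j0 <> c. Proof. by move=> /(can_inj sK); lia. Qed.


Let t_neq x y : y <> s x -> t y <> x.
Proof. by move=> ne e; apply: ne; rewrite -e tK. Qed.

Let s_neq x x' : x <> x' -> s x <> s x'.
Proof. by move=> ne /(can_inj sK). Qed.

Let R_row x y : R x y -> x <= k.
Proof. by case/(placement_active pR). Qed.

Let R_col x y : R x y -> y <> c.
Proof. by case/(placement_active pR) => _ yk _ e; rewrite e tc ltnn in yk. Qed.

(** The black square of column [j0] is in the last old row [k], so the old rooks of that column lie
    above it. *)
Let R_above x : R x j0 -> x < k.
Proof.
case/(placement_active pR) => xk _ ne.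
by have : x <> k by [move=> e; apply: ne; rewrite e]; lia.
Qed.

(** As [c] is extreme among the columns, row [k.+1] has a single across word, served by
    [(k.+1, j0)], and column [c] a single down word, served by [(i0, c)]. *)
Lemma placement_extreme :
  (forall y, t y < k.+1 -> (y < c) = (j0 < c)) ->
  exists R' : rel nat, placement s t k.+2 R'.
Proof.
move=> side.
have [i0 [i0k _ near]] :=
  @bounded_argmin k.+1 predT (fun x => dist c (s x)) k (ltnSn k) isT.
have {}near y : t y < k.+1 -> [/\ (y < c) = (j0 < c),
    (s i0 < c) = (j0 < c) & dist c (s i0) <= dist c y].
  move=> yk; split; first exact: side.
    by apply: side; rewrite sK.
  by rewrite -(tK y); apply: near.
have ci : c <> s i0 by apply: s_neq; lia.
(* No old column lies strictly between [s i0] and [c], so old rooks of row [i0] are on the side away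
   from [c]. *)
have far y : R i0 y -> (y < s i0) <> (c < s i0).
  by case/(placement_active pR) => _ /near[]; rewrite /dist; lia.
pose r x y :=
  [|| R x y, (x == k.+1) && (y == j0) | (x == i0) && (y == c)].
have rP x y : r x y <-> [\/ R x y, x = k.+1 /\ y = j0 | x = i0 /\ y = c].
  split=> [/or3P[] h|[] h]; try by rewrite /r; lia.
  - by apply: Or31; lia.
  - by apply: Or32; lia.
  - by apply: Or33; lia.
exists r; split.
- move=> x y /rP[/(placement_active pR)[]|[-> ->]|[-> ->]].
  + by split; lia.
  + by split; rewrite ?tj0 //; lia.
  + by split; rewrite ?tc //; lia.
- move=> x y [xk yk yx].
  have [exk|nxk] := eqVneq x k.+1.
    exists j0; first by apply/rP; apply: Or32.
    have := @t_neq k.+1 y; rewrite -/c => ty.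
    by rewrite exk -/c (side y) //; rewrite exk in yx; move: (ty yx); lia.
  have [eyc|nyc] := eqVneq y c.
    have [->|nxi] := eqVneq x i0.
      by exists c; [apply/rP; apply: Or33 | rewrite eyc].
    (* For any other old row, [s i0] lies between [s x] and [c], so [(x, c)] joins the old word of
       [(x, s i0)]. *)
    have sxi : s i0 <> s x by apply: s_neq; lia.
    have [|y' Ry' e] := across_ex pR (x := x) (y := s i0).
      by split; rewrite ?sK //; lia.
    exists y'; first by apply/rP; apply: Or31.
    have [] := near (s x); first by rewrite sK; lia.
    by rewrite e eyc /dist; lia.
  have ty := @t_neq k.+1 y (elimN eqP nyc).
  have [|y' Ry' e] := across_ex pR (x := x) (y := y); first by split; lia.
  by exists y' => //; apply/rP; apply: Or31.
- move=> x y [xk yk yx].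
  have [eyc|nyc] := eqVneq y c.
    exists i0; first by apply/rP; apply: Or33.
    rewrite eyc tc; have : x <> k.+1 by move=> e; apply: yx; rewrite eyc e.
    by lia.
  have ty := @t_neq k.+1 y (elimN eqP nyc).
  have tx := t_neq yx.
  have [exk|nxk] := eqVneq x k.+1; last first.
    have [|x' Rx' e] := down_ex pR (x := x) (y := y); first by split; lia.
    by exists x' => //; apply/rP; apply: Or31.
  have [ej|nj] := eqVneq y j0.
    by exists k.+1; [apply/rP; apply: Or32 | rewrite exk].
  (* In an old column other than [j0], the square in row [k.+1] extends the down word of row [k]. *)
  have tyk := @t_neq k y (elimN eqP nj).
  have [|x' Rx' e] := down_ex pR (x := k) (y := y).
    by split=> //; [lia | exact/eqP].
  by exists x'; [apply/rP; apply: Or31 | lia].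
- move=> x y y' /rP[Rxy|[ex ->]|[ex ->]] /rP[Rxy'|[ex' ->]|[ex' ->]] //.
  + exact: (across_inj pR).
  + by move/R_row: Rxy; lia.
  + by move: Rxy; rewrite ex' => /far.
  + by move/R_row: Rxy'; lia.
  + by lia.
  + by move: Rxy'; rewrite ex => /far h e; case: h.
  + by lia.
- move=> x x' y /rP[Rxy|[-> ey]|[-> ey]] /rP[Rxy'|[-> ey']|[-> ey']] //.
  + exact: (down_inj pR).
  + by move: Rxy; rewrite ey' tj0 => /R_above; lia.
  + by move/R_col: Rxy.
  + by move: Rxy'; rewrite ey tj0 => /R_above; lia.
  + by rewrite ey in ey'; case: j0c.
  + by move/R_col: Rxy'.
  + by rewrite ey in ey'; case: j0c.
Qed.

(** Row [k.+1] has two across words, served at [j0] and [j]. Both words of the removed rook [(x, j)]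
    keep a rook: [(k.+1, j)] in the down word, [(x, c)] in the across word. *)
Lemma placement_inner (i : nat) :
  i < k.+1 -> (s i < c) != (j0 < c) -> exists R' : rel nat, placement s t k.+2 R'.
Proof.
move=> ik iside.
have {i ik iside} [i [ik iside near]] := @bounded_argmin k.+1
  (fun x => (s x < c) != (j0 < c)) (fun x => dist c (s x)) i ik iside.
set j := s i in iside near.
have tj : t j = i by apply: sK.
have jc : j <> c by apply: s_neq; lia.
have jj0 : j <> j0 by move=> e; rewrite e eqxx in iside.
(* As [j <> j0], the black square of column [j] is above row [k], so the word of [(k, j)] is the one
   below it. *)
have [|x Rxj] := down_ex pR (x := k) (y := j).
  by split; rewrite ?tj //; lia.
rewrite tj => xi.
have [xk _ jx] := placement_active pR Rxj.
have sxc : s x <> c by apply: s_neq; lia.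
(* Either [s x] lies across [c] from [j], or it is at least as far from [c] as [j]; so [(x, j)] and
   [(x, c)] share an across word. *)
have jcx : (j < s x) = (c < s x).
  by have := near x xk; rewrite /dist; lia.
pose r a b := [|| R a b && ~~ ((a == x) && (b == j)),
  (a == k.+1) && ((b == j0) || (b == j)) | (a == x) && (b == c)].
have rP a b : r a b <-> [\/ R a b /\ ~ (a = x /\ b = j),
    a = k.+1 /\ (b = j0 \/ b = j) | a = x /\ b = c].
  split=> [/or3P[] h|[] h]; try by rewrite /r; lia.
  - by apply: Or31; lia.
  - by apply: Or32; lia.
  - by apply: Or33; lia.
exists r; split.
- move=> a b /rP[[/(placement_active pR)[] + + + _]|[-> [->|->]]|[-> ->]].
  + by split; lia.
  + by split; rewrite ?tj0 //; lia.
  + by split; rewrite ?tj //; lia.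
  + by split; rewrite ?tc; lia.
- move=> a b [ak bk ba].
  have [eak|nak] := eqVneq a k.+1.
    rewrite eak -/c in ba *.
    have [e|e] := eqVneq (b < c) (j0 < c).
      by exists j0 => //; apply/rP; apply: Or32; split; [|left].
    by exists j; [apply/rP; apply: Or32; split; [|right] | lia].
  have [ebc|nbc] := eqVneq b c.
    have [->|nax] := eqVneq a x.
      by exists c; [apply/rP; apply: Or33 | rewrite ebc].
    have sac : s a <> c by apply: s_neq; lia.
    (* Seen from [s a], one of [j] and [j0] lies beyond [c], hence in the across word of [(a, c)].
       The old rook of that word is kept, as [a] differs from [x]. *)
    have [b0 [b0k b0a b0c]] :
        exists b0, [/\ t b0 < k.+1, b0 <> s a & (b0 < s a) = (c < s a)].
      have [e|e] := eqVneq (s a < c) (j0 < c).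
        by exists j; rewrite tj; split=> //; lia.
      by exists j0; rewrite tj0; split=> //; lia.
    have [|b' Rb' e] := across_ex pR (x := a) (y := b0); first by split; lia.
    by exists b'; [apply/rP; apply: Or31; split=> //; lia | rewrite e ebc].
  have tb := @t_neq k.+1 b (elimN eqP nbc).
  have [|b' Rb' e] := across_ex pR (x := a) (y := b); first by split; lia.
  (* If the rook found is the removed [(x, j)], then [(x, c)] takes over its word. *)
  have [/andP[/eqP ea /eqP eb]|neq] := boolP ((a == x) && (b' == j)).
    by exists c; [apply/rP; apply: Or33 | rewrite -e eb ea].
  by exists b' => //; apply/rP; apply: Or31; split=> //; lia.
- move=> a b [ak bk ba].
  have [ebc|nbc] := eqVneq b c.
    exists x; first by apply/rP; apply: Or33.
    rewrite ebc tc; have : a <> k.+1 by move=> e; apply: ba; rewrite ebc e.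
    by lia.
  have tb := @t_neq k.+1 b (elimN eqP nbc).
  have ta := t_neq ba.
  have [ebj|nbj] := eqVneq b j.
    (* Above the black square of column [j] the old rook is kept; below it, [(k.+1, j)] replaces
       [(x, j)]. *)
    have [ai|ia] := ltnP a i.
      have [|a' Ra' e] := down_ex pR (x := a) (y := b); first by split; lia.
      exists a' => //; apply/rP; apply: Or31; split=> // -[ea' _].
      by rewrite ebj tj in e; lia.
    exists k.+1; last by rewrite ebj tj; lia.
    by apply/rP; apply: Or32; split; [|right].
  have [eak|nak] := eqVneq a k.+1; last first.
    have [|a' Ra' e] := down_ex pR (x := a) (y := b); first by split; lia.
    by exists a' => //; apply/rP; apply: Or31; split=> //; lia.
  have [ej|nj] := eqVneq b j0.
    by exists k.+1; [apply/rP; apply: Or32; split; [|left] | rewrite eak].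
  have tbk := @t_neq k b (elimN eqP nj).
  have [|a' Ra' e] := down_ex pR (x := k) (y := b).
    by split=> //; [lia | exact/eqP].
  by exists a'; [apply/rP; apply: Or31; split=> //; lia | lia].
(* By [jcx], an old rook of row [x] on the side of [c] shares the word of [(x, j)]. *)
- have clash b : R x b -> (b < s x) = (c < s x) -> b = j.
    by move=> Rxb e; apply: (across_inj pR Rxb Rxj); rewrite e.
  move=> a b b' /rP[[Rab n]|[ea eb]|[ea ->]]
    /rP[[Rab' n']|[ea' eb']|[ea' ->]] //.
  + exact: (across_inj pR).
  + by move/R_row: Rab; lia.
  + by rewrite ea' in Rab n * => /(clash _ Rab) eb; case: n.
  + by move/R_row: Rab'; lia.
  + by rewrite ea -/c; case: eb eb' => -> [] ->; lia.
  + by lia.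
  + by rewrite ea in Rab' n' * => /esym /(clash _ Rab') eb'; case: n'.
  + by lia.
(* The old rooks kept in columns [j0] and [j] are above the black square, the new ones in row [k.+1]
   below it. *)
- have clash a b : R a b -> ~ (a = x /\ b = j) -> b = j0 \/ b = j ->
      a < t b <= k.
    move=> Rab n [eb|eb]; rewrite eb ?tj0 ?tj in Rab n *.
      by rewrite (R_above Rab) leqnn.
    have : a <> x by move=> ea; apply: n.
    have [_ _ /t_neq] := placement_active pR Rab; rewrite tj.
    have := down_inj pR Rab Rxj; rewrite tj; lia.
  have newc b : b = j0 \/ b = j -> b <> c by case=> ->.
  move=> a a' b /rP[[Rab n]|[-> eb]|[-> eb]]
    /rP[[Rab' n']|[-> eb']|[-> eb']] //.
  + exact: (down_inj pR).
  + by move: (clash _ _ Rab n eb'); lia.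
  + by move/R_col: Rab.
  + by move: (clash _ _ Rab' n' eb); lia.
  + by move/newc: eb.
  + by move/R_col: Rab'.
  + by move/newc: eb'.
Qed.

Lemma placement_succ : exists R' : rel nat, placement s t k.+2 R'.
Proof.
have [/existsP[i iside]|/existsPn same] :=
    boolP [exists i : 'I_k.+1, (s i < c) != (j0 < c)].
  exact: placement_inner iside.
apply: placement_extreme => y yk.
by move/(_ (Ordinal yk))/negPn/eqP: same; rewrite /= tK.
Qed.

End Step.

(** The induction starts from one row because the step refers to the last old row [k]. *)
Lemma placement_exists (s t : nat -> nat) (k : nat) :
  cancel s t -> cancel t s -> exists R : rel nat, placement s t k.+1 R.
Proof.
move=> sK tK; elim: k => [|k [R pR]]; last exact: (placement_succ sK tK pR).
by exists (fun _ _ => false); apply: placement1.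
Qed.

(** * Extension of permutations of ['I_n] to [nat], by the identity beyond [n] *)

Definition extend (n : nat) (f : 'I_n -> 'I_n) (x : nat) : nat :=
  oapp (fun i => val (f i)) x (insub x).

Lemma extendE (n : nat) (f : 'I_n -> 'I_n) (i : 'I_n) : extend f i = f i.
Proof. by rewrite /extend valK. Qed.

Lemma extendK (n : nat) (f g : 'I_n -> 'I_n) :
  cancel f g -> cancel (extend f) (extend g).
Proof.
move=> fK x; have [xn|nx] := ltnP x n.
  by rewrite -[x]/(val (Ordinal xn)) !extendE fK.
by rewrite /extend !insubN -?leqNgt.
Qed.

Lemma extend_lt (n : nat) (f : 'I_n -> 'I_n) (x : nat) : extend f x < n -> x < n.
Proof. by rewrite /extend; case: insubP => [i -> //|]. Qed.

(** For [p] distinct from [m], this cuts out the word of [p] in a row or column whose black square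
    is at [m]. *)
Definition same_side (n : nat) (m p x : 'I_n) : bool :=
  (x != m) && ((x < m) == (p < m)).

Lemma same_side_interval (n : nat) (m p : 'I_n) : p != m ->
  exists a b : 'I_n, a <= p <= b /\ forall x : 'I_n, (a <= x <= b) = same_side m p x.
Proof.
move=> /eqP pm; have {}pm : (p : nat) <> m by move/val_inj.
have nm := ltn_ord m; have np := ltn_ord p.
have ext (a b : nat) (an : a < n) (bn : b < n) :
    a <= p <= b ->
    (forall x : nat, x < n -> (a <= x <= b) = ((x : nat) != m) && ((x < m) == (p < m))) ->
  exists a b : 'I_n, a <= p <= b /\ forall x : 'I_n, (a <= x <= b) = same_side m p x.
  by move=> apb ab; exists (Ordinal an), (Ordinal bn); split=> // x; apply: ab.
have [ltpm|lemp] := ltnP p m.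
  by apply: (ext 0 m.-1) => [||| x xn]; lia.
by apply: (ext m.+1 n.-1) => [||| x xn]; lia.
Qed.

Lemma interval_same_side (n : nat) (m a b x : 'I_n) :
  ~~ (a <= m <= b) -> a <= x <= b -> same_side m a x.
Proof.
move=> mab xab; rewrite /same_side; have -> : x != m.
  by apply: contra mab => /eqP <-.
by have := mab; lia.
Qed.

(** * Words as the sides of black squares *)

Section Words.
Variables (n : nat) (B : crossword_grid n) (s t : 'I_n -> 'I_n).
Hypothesis Bs : forall i j, ((i, j) \in B) = (j == s i).
Hypothesis Bt : forall i j, ((i, j) \in B) = (i == t j).

(** A run avoids the black square, so it lies on one side of it; that whole side is itself a run,
    and maximality makes the two equal. *)
Lemma across_wordP (W : {set square n}) : across_word B W ->
  exists i j, j != s i /\ W = [set x | (x.1 == i) && same_side (s i) j x.2].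
Proof.
case/maxsetP=> /existsP[i /existsP[a /existsP[b /and3P[ab /eqP-> sub]]]] maxW.
have nab : ~~ (a <= s i <= b).
  apply: contraL sub => iab; apply/subsetPn; exists (i, s i).
    by rewrite inE eqxx.
  by rewrite !inE Bs eqxx.
have na : a != s i by apply: contra nab => /eqP <-; rewrite leqnn ab.
exists i, a; split=> //; apply/esym/maxW; last first.
  apply/subsetP=> x; rewrite !inE => /andP[-> xab].
  exact: interval_same_side nab xab.
have [a' [b' [aab ab'E]]] := same_side_interval na.
apply/existsP; exists i; apply/existsP; exists a'; apply/existsP; exists b'.
apply/and3P; split; first by case/andP: aab; apply: leq_trans.
  by apply/eqP/setP=> x; rewrite !inE ab'E.
apply/subsetP=> -[i' x]; rewrite !inE Bs /= => /andP[/eqP->].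
by case/andP.
Qed.

Lemma down_wordP (W : {set square n}) : down_word B W ->
  exists i j, i != t j /\ W = [set x | (x.2 == j) && same_side (t j) i x.1].
Proof.
case/maxsetP=> /existsP[j /existsP[a /existsP[b /and3P[ab /eqP-> sub]]]] maxW.
have nab : ~~ (a <= t j <= b).
  apply: contraL sub => jab; apply/subsetPn; exists (t j, j).
    by rewrite inE eqxx.
  by rewrite !inE Bt eqxx.
have na : a != t j by apply: contra nab => /eqP <-; rewrite leqnn ab.
exists a, j; split=> //; apply/esym/maxW; last first.
  apply/subsetP=> x; rewrite !inE => /andP[-> xab].
  exact: interval_same_side nab xab.
have [a' [b' [aab ab'E]]] := same_side_interval na.
apply/existsP; exists j; apply/existsP; exists a'; apply/existsP; exists b'.
apply/and3P; split; first by case/andP: aab; apply: leq_trans.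
  by apply/eqP/setP=> x; rewrite !inE ab'E.
apply/subsetP=> -[x j']; rewrite !inE Bt /= => /andP[/eqP->].
by case/andP.
Qed.

End Words.

(** * Permutation grids and the final placement *)

Lemma permutation_gridP (n : nat) (B : crossword_grid n) :
  permutation_grid B -> exists s t : 'I_n -> 'I_n,
  [/\ cancel s t, cancel t s, forall i j, ((i, j) \in B) = (j == s i)
    & forall i j, ((i, j) \in B) = (i == t j)].
Proof.
case=> rowB colB.
have /fin_all_exists[s Bs] i : exists j0, forall j, ((i, j) \in B) = (j == j0).
  have /eqP/cards1P[j0 /setP ej] := rowB i.
  by exists j0 => j; have := ej j; rewrite !inE.
have /fin_all_exists[t Bt] j : exists i0, forall i, ((i, j) \in B) = (i == i0).
  have /eqP/cards1P[i0 /setP ei] := colB j.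
  by exists i0 => i; have := ei i; rewrite !inE.
exists s, t; split=> //.
  by move=> i; apply/esym/eqP; rewrite -Bt Bs.
by move=> j; apply/esym/eqP; rewrite -Bs Bt.
Qed.

Theorem proposition3p3 (n : nat) (n_gt0 : 0 < n) (B : crossword_grid n)
  (permB : permutation_grid B) :
  exists R : {set square n}, complete_rook_placement B R.
Proof.
have [s [t [sK tK Bs Bt]]] := permutation_gridP permB.
have [P] := placement_exists n.-1 (extendK sK) (extendK tK).
rewrite prednK // => pP.
(* At stage [n] the subgrid is the whole grid. *)
have actE (i j : 'I_n) : j != s i -> active (extend s) (extend t) n i j.
  move=> ji; split; rewrite ?extendE ?ltn_ord //.
  by move/val_inj=> e; rewrite e eqxx in ji.
have neqP (i j : 'I_n) : P i j -> j != s i.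
  case/(placement_active pP) => _ _; rewrite extendE => ne.
  by apply: contra_notN ne => /eqP->.
have colP x y : P x y -> y < n.
  by case/(placement_active pP) => _ yn _; apply: extend_lt yn.
have rowP x y : P x y -> x < n by case/(placement_active pP).
exists [set x : square n | P x.1 x.2]; split.
- apply/subsetP=> -[i j]; rewrite !inE Bs; exact: neqP.
- move=> W /(across_wordP Bs)[i [j [ji ->]]]; apply/eqP/cards1P.
  have [y Piy] := across_ex pP (actE i j ji).
  rewrite extendE => e; exists (i, Ordinal (colP _ _ Piy)).
  apply/setP=> -[i' j']; rewrite !inE xpair_eqE /same_side /=.
  have [->|] := eqVneq i' i; last by rewrite andbF.
  apply/idP/eqP => [/and4P[Pij' _ _ /eqP e']|->].
    apply: val_inj; apply: (across_inj pP Pij' Piy).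
    by rewrite extendE e e'.
  by rewrite /= Piy e eqxx andbT; apply: (neqP i (Ordinal (colP _ _ Piy))).
- move=> W /(down_wordP Bt)[i [j [ij ->]]]; apply/eqP/cards1P.
  have ji : j != s i by apply: contra ij => /eqP->; rewrite sK.
  have [x Pxj] := down_ex pP (actE i j ji).
  rewrite extendE => e; exists (Ordinal (rowP _ _ Pxj), j).
  apply/setP=> -[i' j']; rewrite !inE xpair_eqE /same_side /=.
  have [->|] := eqVneq j' j; last by rewrite !andbF.
  rewrite andbT; apply/idP/eqP => [/and4P[Pij' _ _ /eqP e']|->].
    apply: val_inj; apply: (down_inj pP Pij' Pxj).
    by rewrite extendE e e'.
  rewrite /= Pxj e eqxx andbT; set i0 := Ordinal _.
  by apply: contraL (neqP i0 j Pxj) => /eqP->; rewrite tK eqxx.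
Qed.
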